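(* Let $X$ be a first-countable topological space that admits a continuous bijection onto a GO-space $Y$. Then $X$ admits a continuous bijection onto a first-countable GO-space.
   Context: A linearly ordered topological space (LOTS) is a linearly ordered set $\langle L,<\rangle$ with at least two points, equipped with the topology generated by (i.e. having as a subbase) all sets of the form $\{x\in L : x<a\}$ and $\{x\in L : x>a\}$ with $a\in L$; a singleton is also regarded as a LOTS. A generalized ordered space (GO-space) is any topological space that is a subspace of a LOTS (up to homeomorphism), with the subspace topology. Equivalently (Čech), a Hausdorff space with a linear order $<$ is a GO-space with respect to $<$ if and only if its topology is generated by a collection of $<$-convex subsets. A continuous bijection need not have a continuous inverse. *)

(* Defs.v *)
From HB Require Import structures.
From mathcomp Require Import all_boot all_order.
From mathcomp Require Import all_classical topology.

Set Implicit Arguments.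
Unset Strict Implicit.
Unset Printing Implicit Defensive.

Local Open Scope classical_set_scope.

Definition first_countable (T : topologicalType) : Prop :=
  forall x : T, exists B : set (set T),
    [/\ countable B, B `<=` open_nbhs x &
        forall U : set T, nbhs x U -> exists2 V : set T, B V & V `<=` U].

Definition homeomorphic (S T : topologicalType) : Prop :=
  exists (f : S -> T) (g : T -> S),
    [/\ cancel f g, cancel g f, continuous f & continuous g].

(* The topology of an orderTopologicalType is the one generated by the open
   rays, so a LOTS is a nonempty such type (singletons included); a set A of L
   coerces to its subtype, which carries the subspace topology. *)
Definition GO_space (Y : topologicalType) : Prop :=
  exists (d : Order.disp_t) (L : orderTopologicalType d) (A : set L),
    [set: L] !=set0 /\ homeomorphic Y A.

Definition continuous_bijection (S T : topologicalType) (f : S -> T) : Prop :=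
  continuous f /\ bijective f.

(* Main.v *)
(* Order X through its bijection with Y; then all open rays are open in X.  Let
   Z be X with the topology generated by the open rays together with those
   closed rays [x, ->) and (<-, x] that are open in X.  Splitting points turns Z
   into a subspace of a LOTS.  Z is first countable: on the left of x, either
   [x, ->) is open in X and hence in Z, or every member of a countable base at x
   in X contains a point below x, and these points are cofinal below x because
   X refines the order topology; likewise on the right. *)
Require Import Defs.
From HB Require Import structures.
From mathcomp Require Import all_boot all_order.
From mathcomp Require Import all_classical topology.
From mathcomp Require Import interval.

Set Implicit Arguments.
Unset Strict Implicit.
Unset Printing Implicit Defensive.

Import Order.TTheory.

Local Open Scope classical_set_scope.
Local Open Scope order_scope.

(** * Neighbourhoods and countable local bases in ordered spaces *)

Lemma countable_setU T (A B : set T) :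
  countable A -> countable B -> countable (A `|` B).
Proof.
move=> cA cB; rewrite -bigcup2E; apply: bigcup_countable => // i _.
by case: i => [|[|i]].
Qed.

(** An open interval around [x] is cut into its two end conditions, an infinite end giving [setT],
    so that the two sides of [x] can be treated separately. *)
Lemma order_nbhs_rays d (L : orderTopologicalType d) (x : L) (U : set L) :
  nbhs x U -> exists A B : set L,
    [/\ A `&` B `<=` U,
        A = setT \/ exists2 q, q < x & A = [set y | q < y] &
        B = setT \/ exists2 q, x < q & B = [set y | y < q]].
Proof.
rewrite itv_nbhsE => -[[l r] [oi xi] iU].
move: xi; rewrite itv_boundlr => /andP[xl xr].
exists [set y | l <= BLeft y], [set y | BRight y <= r]; split.
- by move=> y [/= yl yr]; apply: iU => /=; rewrite itv_boundlr yl.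
- case: l oi xl {iU} => [b q|b] oi xl.
    have bF := itv_open_ends_lside oi; subst b.
    by right; exists q.
  have bT := itv_open_ends_linfty oi; subst b.
  by left; apply/seteqP.
- case: r oi xr {iU} => [b q|b] oi xr.
    have bT := itv_open_ends_rside oi; subst b.
    by right; exists q.
  have bF := itv_open_ends_rinfty oi; subst b.
  by left; apply/seteqP.
Qed.

Lemma continuous_order_topology d (S : topologicalType)
    (L : orderTopologicalType d) (e : S -> L) :
  (forall q, open [set s | q < e s]) -> (forall q, open [set s | e s < q]) ->
  continuous e.
Proof.
move=> oR oL s U /order_nbhs_rays[A [B [ABU hA hB]]].
apply: (filterS (P := e @^-1` A `&` e @^-1` B)).
  by move=> y [Ay By]; apply: ABU.
apply: filterI.
- case: hA => [->|[q qx ->]]; first exact: filterT.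
  exact: (open_nbhs_nbhs (conj (oR q) qx)).
- case: hB => [->|[q qx ->]]; first exact: filterT.
  exact: (open_nbhs_nbhs (conj (oL q) qx)).
Qed.

Lemma ray_open_gt d (L : orderTopologicalType d) (q : L) :
  open [set y | q < y].
Proof. by rewrite -set_itvoy; exact: rray_open. Qed.

Lemma ray_open_lt d (L : orderTopologicalType d) (q : L) :
  open [set y | y < q].
Proof. by rewrite -set_itvNyo; exact: lray_open. Qed.

(** A basic neighbourhood is bounded by at most one ray on each side, so pairwise intersections of
    two one-sided countable families give a local base. Only traces on [A] have to be small. *)
Lemma first_countable_subspace d (L : orderTopologicalType d) (A : set L) :
  (forall x, A x -> exists D : set (set L),
    [/\ countable D, D `<=` open_nbhs x &
        forall q, q < x -> exists2 V, D V & A `&` V `<=` [set y | q < y]]) ->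
  (forall x, A x -> exists D : set (set L),
    [/\ countable D, D `<=` open_nbhs x &
        forall q, x < q -> exists2 V, D V & A `&` V `<=` [set y | y < q]]) ->
  first_countable A.
Proof.
move=> hl hr z.
have Az : A (\val z) by apply: set_mem; exact: (valP z).
have [D [cD Dx Dq]] := hl _ Az.
have [E [cE Ex Eq]] := hr _ Az.
(* [setT] serves a side on which the neighbourhood is unbounded. *)
exists [set \val @^-1` (V `&` W) | V in D `|` [set setT] & W in E `|` [set setT]].
have DTx V : (D `|` [set setT]) V -> open_nbhs (\val z) V.
  by move=> [/Dx|->] //; exact: open_nbhsT.
have ETx V : (E `|` [set setT]) V -> open_nbhs (\val z) V.
  by move=> [/Ex|->] //; exact: open_nbhsT.
split.
- have cDE : countable ((D `|` [set setT]) `*` (E `|` [set setT])).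
    by apply: countableX; apply: countable_setU.
  by rewrite image2E; apply: sub_countable cDE; exact: card_image_le.
- move=> _ [V /DTx VD] [W /ETx WE] <-.
  have [oVW VWz] := open_nbhsI VD WE.
  by split=> //; exists (V `&` W).
- move=> U [_ [[O oO <-] Oz OU]].
  have [P [Q [PQO hP hQ]]] := order_nbhs_rays (open_nbhs_nbhs (conj oO Oz)).
  have [V DV VP] : exists2 V, (D `|` [set setT]) V & A `&` V `<=` P.
    case: hP => [->|[q qz ->]]; first by exists setT => //; right.
    by have [V DV Vq] := Dq _ qz; exists V => //; left.
  have [W EW WQ] : exists2 W, (E `|` [set setT]) W & A `&` W `<=` Q.
    case: hQ => [->|[q qz ->]]; first by exists setT => //; right.
    by have [W EW Wq] := Eq _ qz; exists W => //; left.
  exists (\val @^-1` (V `&` W)); first by exists V => //; exists W.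
  move=> y [Vy Wy]; apply/OU/PQO.
  have Ay : A (\val y) by apply: set_mem; exact: (valP y).
  by split; [exact: VP|exact: WQ].
Qed.

(* Every V in a countable base at x meets the open left ray at x, for otherwise
   the closed right ray would be open; one point from each V will do. *)
Lemma countable_cofinal (X : topologicalType) d (T : orderType d) (h : X -> T)
    (x : X) :
  first_countable X -> injective h -> (forall t, open [set y | t < h y]) ->
  ~ open [set y | h x <= h y] ->
  exists C : set X, [/\ countable C, forall c, C c -> h c < h x &
    forall t, t < h x -> exists2 c, C c & t < h c].
Proof.
move=> /(_ x)[B [cB Bx Bnbhs]] hinj oh nox.
have /choice[c hc] V : exists c, B V -> V c /\ h c < h x.
  have [BV|nBV] := pselect (B V); last by exists x.
  apply: contrapT => nc; apply: nox.
  rewrite (_ : mkset _ = [set y | h x < h y] `|` V).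
    by apply: openU; [exact: oh|exact: (Bx _ BV).1].
  apply/seteqP; split=> y /=.
    rewrite le_eqVlt => /orP[/eqP/hinj <-|]; last by left.
    by right; exact: (Bx _ BV).2.
  case=> [/ltW //|Vy]; rewrite leNgt; apply/negP => yx.
  by apply: nc; exists y.
exists (c @` B); split.
- exact: (sub_countable (card_image_le _ _) cB).
- by move=> _ [V BV <-]; have [] := hc V BV.
- move=> t tx; have /Bnbhs[V BV Vt] := open_nbhs_nbhs (conj (oh t) tx).
  exists (c V); first by exists V.
  by apply: Vt; have [] := hc V BV.
Qed.

(** * Splitting the points of an ordered set *)

Section split_points.
Context (X : topologicalType) d (T : orderType d) (h : X -> T).

(* A point t of T becomes (t, 1); it gets the extra left neighbour (t, 0), resp.
   right neighbour (t, 2), exactly when the corresponding closed ray is open in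
   X. *)
Definition splittable : pred (T *l nat) := fun p =>
  `[< [\/ p.2 = 1%N, p.2 = 0%N /\ open [set y | p.1 <= h y]
        | p.2 = 2%N /\ open [set y | h y <= p.1]] >].

Definition split_order : Type := {p : T *l nat | splittable p}.

HB.instance Definition _ := SubChoice.on split_order.
HB.instance Definition _ :=
  [SubChoice_isSubOrder of split_order by <: with d].

(** The ambient LOTS; the set of centres of the points [h x] in it will be the space [Z]. *)
Definition split_space : Type := order_topology split_order.
HB.instance Definition _ := OrderTopological.on split_space.

Lemma splittable1 t : splittable (t, 1%N).
Proof. by apply/asboolP; constructor 1. Qed.

Definition split_center (t : T) : split_space := exist _ (t, 1%N) (splittable1 t).

Lemma lt_split_center (p : split_space) t :
  (p < split_center t) =
  ((\val p).1 < t) || ((\val p).1 == t) && ((\val p).2 == 0%N).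
Proof.
(* The order of [split_space] is by conversion that of [split_order], where the subtype and
   lexicographic rules apply. *)
rewrite -[LHS]/((p : split_order) < split_center t) ltEsub ltEprodlexi /=.
by case: (ltgtP (\val p).1 t) => //= _; rewrite ltEnat /= ltnS leqn0.
Qed.

Lemma split_center_lt (p : split_space) t :
  (split_center t < p) =
  (t < (\val p).1) || (t == (\val p).1) && (1 < (\val p).2)%N.
Proof.
rewrite -[LHS]/((split_center t : split_order) < p) ltEsub ltEprodlexi /=.
by case: (ltgtP t (\val p).1).
Qed.

Lemma split_spaceP (p : split_space) :
  [\/ (\val p).2 = 1%N, (\val p).2 = 0%N /\ open [set y | (\val p).1 <= h y]
    | (\val p).2 = 2%N /\ open [set y | h y <= (\val p).1]].
Proof. by case: p => p /= /asboolP. Qed.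

Hypothesis open_gt : forall t, open [set y | t < h y].
Hypothesis open_lt : forall t, open [set y | h y < t].

(** The preimage of a ray with endpoint [p] is an open ray, except for the right ray at an added
    left neighbour and the left ray at an added right neighbour. Those give closed rays, which are
    open in [X] by the very condition for adding [p]. *)
Lemma split_center_continuous : continuous (split_center \o h).
Proof.
apply: continuous_order_topology => p; have := split_spaceP p => hp.
- rewrite (_ : mkset _ = [set y | ((\val p).1 < h y) ||
    ((\val p).1 == h y) && ((\val p).2 == 0%N)]); last first.
    by apply/seteqP; split=> y /=; rewrite lt_split_center.
  case: hp => [->|[-> o]|[-> _]].
  + by under eq_set do rewrite andbF orbF.
  + by under eq_set do rewrite andbT orbC -le_eqVlt.
  + by under eq_set do rewrite andbF orbF.
- rewrite (_ : mkset _ = [set y | (h y < (\val p).1) ||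
    (h y == (\val p).1) && (1 < (\val p).2)%N]); last first.
    by apply/seteqP; split=> y /=; rewrite split_center_lt.
  case: hp => [->|[-> _]|[-> o]].
  + by under eq_set do rewrite andbF orbF.
  + by under eq_set do rewrite andbF orbF.
  + by under eq_set do rewrite andbT orbC -le_eqVlt.
Qed.

Hypothesis h_inj : injective h.
Hypothesis fcX : first_countable X.

Lemma split_centers_first_countable :
  first_countable (range (split_center \o h)).
Proof.
apply: first_countable_subspace => _ [x _ <-].
- have [o|no] := pselect (open [set y | h x <= h y]).
    have sx : splittable (h x, 0%N) by apply/asboolP; constructor 2.
    (* No centre lies strictly between [p0] and the centre of [h x], so the single ray above [p0]
       suffices. *)
    pose p0 : split_space := exist _ (h x, 0%N) sx.
    exists [set [set y | p0 < y]]; split.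
    + exact: countable1.
    + move=> _ ->; split; first exact: ray_open_gt.
      by rewrite /= lt_split_center /= eqxx orbT.
    + move=> q; rewrite /= lt_split_center => qx.
      exists [set y | p0 < y] => // _ [[y _ <-]] /=.
      rewrite !lt_split_center /= => /orP[xy|/andP[/eqP <- _]//].
      case/orP: qx => [qx|/andP[/eqP -> _]]; last by rewrite xy.
      by rewrite (lt_trans qx).
  have [C [cC Cx Cq]] := countable_cofinal fcX h_inj open_gt no.
  exists [set [set y | split_center (h c) < y] | c in C]; split.
  + exact: sub_countable (card_image_le _ _) cC.
  + move=> _ [c /Cx cx <-]; split; first exact: ray_open_gt.
    by rewrite /= lt_split_center /= cx.
  + move=> q; rewrite /= lt_split_center => qx.
    (* If [q] were the left neighbour of the centre, the closed right ray at [h x] would be open,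
       against [no]. *)
    have {}qx : (\val q).1 < h x.
      case/orP: qx => // /andP[/eqP qx /eqP q0].
      by case: (split_spaceP q); rewrite q0 // qx => -[] // _ o; case: no.
    have [c Cc qc] := Cq _ qx; exists [set y | split_center (h c) < y].
      by exists c.
    move=> _ [[y _ <-]] /=; rewrite split_center_lt lt_split_center /= andbF orbF.
    by move=> /(lt_trans qc) ->.
- have [o|no] := pselect (open [set y | h y <= h x]).
    have sx : splittable (h x, 2%N) by apply/asboolP; constructor 3.
    pose p2 : split_space := exist _ (h x, 2%N) sx.
    exists [set [set y | y < p2]]; split.
    + exact: countable1.
    + move=> _ ->; split; first exact: ray_open_lt.
      by rewrite /= split_center_lt /= eqxx orbT.
    + move=> q; rewrite /= split_center_lt => xq.
      exists [set y | y < p2] => // _ [[y _ <-]] /=.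
      rewrite !split_center_lt /= => /orP[yx|/andP[/eqP -> _]//].
      case/orP: xq => [xq|/andP[/eqP <- _]]; last by rewrite yx.
      by rewrite (lt_trans yx).
  (* Passing to the dual order [T^d] turns cofinal below [h x] into coinitial above it. *)
  have [C [cC Cx Cq]] := @countable_cofinal X _ T^d h x fcX h_inj open_lt no.
  exists [set [set y | y < split_center (h c)] | c in C]; split.
  + exact: sub_countable (card_image_le _ _) cC.
  + move=> _ [c /Cx cx <-]; split; first exact: ray_open_lt.
    by rewrite /= split_center_lt /=; apply/orP; left; exact: cx.
  + move=> q; rewrite /= split_center_lt => xq.
    have {}xq : h x < (\val q).1.
      case/orP: xq => // /andP[/eqP xq q1].
      case: (split_spaceP q) q1 => [->|[-> _]|[_]] //.
      by rewrite -xq => /no.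
    have [c Cc cq] := Cq _ xq; exists [set y | y < split_center (h c)].
      by exists c.
    move=> _ [[y _ <-]] /=; rewrite lt_split_center split_center_lt /= andbF orbF.
    by move=> yc; rewrite (lt_trans yc cq).
Qed.

End split_points.

Theorem theorem2p1 (X Y : topologicalType) :
  first_countable X ->
  GO_space Y ->
  (exists f : X -> Y, continuous_bijection f) ->
  exists Z : topologicalType,
    [/\ GO_space Z, first_countable Z &
        exists g : X -> Z, continuous_bijection g].
Proof.
move=> fcX [d [L [A [[l0 _] [u [v [uK vK cu cv]]]]]]] [f [cf bf]].
pose h : X -> L := \val \o u \o f.
have ch : continuous h.
  move=> x; apply: continuous_comp; first exact: cf.
  by apply: continuous_comp; [exact: cu|exact: initial_continuous].
have h_inj : injective h.
  by move=> x y /val_inj /(can_inj uK) /(bij_inj bf).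
have oR t : open [set y | t < h y].
  exact: (open_comp (fun x _ => ch x) (ray_open_gt t)).
have oL t : open [set y | h y < t].
  exact: (open_comp (fun x _ => ch x) (ray_open_lt t)).
(* All of [L] is split, although [h] need not be onto; [range e] keeps only the centres that come
   from [X]. *)
pose e := @split_center X d L h \o h.
exists (range e); split.
(* The point [l0] of [L] makes the LOTS nonempty even when [X] is empty. *)
- exists d, (split_space h), (range e); split; first by exists (split_center h l0).
  by exists id, id; split=> // x U.
- exact: split_centers_first_countable.
- pose g x : range e := exist _ (e x) (mem_set (imageT e x)).
  exists g; split.
    apply: continuous_comp_initial; exact: split_center_continuous.
  rewrite -setTT_bijective; split=> //.
  + move=> x y _ _ /(congr1 \val) /(congr1 \val) /(congr1 fst).
    exact: h_inj.
  + by move=> z _; have [x _ ex] := set_mem (valP z); exists x => //; exact: val_inj.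
Qed.
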